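(* Let $n\ge 2$ and let $\mathbb{X}$ be a two-dimensional real Banach space whose unit sphere $S_\mathbb{X}$ is a regular $2n$-gon. Then: (i) if $n$ is odd, $\Gamma(\mathbb{X})=\dfrac{\cos\left(\frac{n-2}{2n}\pi\right)}{2\cos\left(\frac{\pi}{2n}\right)}$; (ii) if $n$ is even, $\Gamma(\mathbb{X})=\dfrac{1}{4\cos\left(\frac{\pi}{2n}\right)}\left(\cos\left(\frac{n-3}{2n}\pi\right)+\cos\left(\frac{n-1}{2n}\pi\right)\right)$.
   Context: All normed spaces are real; $S_\mathbb{X}=\{x\in\mathbb{X}:\|x\|=1\}$. A two-dimensional space is identified with $\mathbb{R}^2$; ''$S_\mathbb{X}$ is a regular $2n$-gon'' means that $S_\mathbb{X}$ is the boundary of a regular (in the Euclidean sense) $2n$-gon centred at the origin, e.g. with vertices $v_j=(\cos\frac{j-1}{n}\pi,\sin\frac{j-1}{n}\pi)$, $1\le j\le 2n$. Birkhoff-James orthogonality: $x\perp_B y$ means $\|x+\lambda y\|\ge\|x\|$ for all $\lambda\in\mathbb{R}$. Norm derivatives: $\rho'_{\pm}(x,y)=\|x\|\lim_{t\to 0^{\pm}}\frac{\|x+ty\|-\|x\|}{t}$ and $\rho'(x,y)=\frac12(\rho'_+(x,y)+\rho'_-(x,y))$. The constant $\Gamma(\mathbb{X})$ is defined by $\Gamma(\mathbb{X})=\sup\{|\rho'(x,y)|: x,y\in S_\mathbb{X},\ x\perp_B y\}$. *)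

(* Defs.v *)
From mathcomp Require Export all_boot all_order all_algebra.
From mathcomp Require Export all_classical all_reals all_analysis.

Set Implicit Arguments.
Unset Strict Implicit.
Unset Printing Implicit Defensive.

Import Order.TTheory GRing.Theory Num.Theory.
Import numFieldNormedType.Exports.

Local Open Scope classical_set_scope.
Local Open Scope ring_scope.

Section NormedSpace.
Context {R : realType} {X : normedModType R}.

Definition unit_sphere : set X := [set x | `|x| = 1].

Definition birkhoff_james (x y : X) : Prop :=
  forall a : R, `|x| <= `|x + a *: y|.

(* The norm is convex, so both one-sided limits exist and [lim] never takes
   its default value here. *)
Definition rho_plus (x y : X) : R :=
  `|x| * lim ((`|x + t *: y| - `|x|) / t @[t --> (0 : R)^'+]).

Definition rho_minus (x y : X) : R :=
  `|x| * lim ((`|x + t *: y| - `|x|) / t @[t --> (0 : R)^'-]).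

Definition rho (x y : X) : R := (rho_plus x y + rho_minus x y) / 2.

End NormedSpace.

Arguments unit_sphere {R} X.

(* Since |rho x y| <= |x| |y|, the set is bounded by 1; it is nonempty as soon
   as X has dimension at least 2, so that [sup] is then the actual supremum. *)
Definition Gamma {R : realType} (X : normedModType R) : R :=
  sup [set r | exists x y : X,
    [/\ unit_sphere X x, unit_sphere X y, birkhoff_james x y
      & r = `|rho x y|]].

Section RegularPolygon.
Context {R : realType}.

Definition plane_point (a b : R) : 'rV[R]_2 :=
  \row_(i < 2) if i == 0 then a else b.

(* Vertex number j (from 0) of the regular m-gon centred at the origin with
   circumradius r whose vertex number 0 has polar angle theta. *)
Definition polygon_vertex (m : nat) (r theta : R) (j : nat) : 'rV[R]_2 :=
  let alpha := theta + j%:R * (2 * pi / m%:R) in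
  plane_point (r * cos alpha) (r * sin alpha).

Definition segment (p q : 'rV[R]_2) : set 'rV[R]_2 :=
  [set z | exists2 t : R, 0 <= t <= 1 & z = (1 - t) *: p + t *: q].

(* The edge with j = m - 1 closes the polygon: vertex m is vertex 0. *)
Definition polygon_boundary (m : nat) (r theta : R) : set 'rV[R]_2 :=
  [set z | exists2 j : nat, (j < m)%N &
    segment (polygon_vertex m r theta j) (polygon_vertex m r theta j.+1) z].

(* Any size and any position around the origin are allowed. *)
Definition regular_polygon_boundary (m : nat) (S : set 'rV[R]_2) : Prop :=
  exists r theta : R, 0 < r /\ S = polygon_boundary m r theta.

End RegularPolygon.

(* Main.v *)
(* Let b = pi/(2n). In the coordinates given by phi, the norm is the maximum of
   the 2n linear forms F_k equal to 1 on the k-th edge of the polygon. At a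
   point x of the sphere lying on edges i and j (i = j unless x is a vertex),
   rho x y is the mean of F_i y and F_j y, and x is orthogonal to y iff
   F_i y * F_j y <= 0. So only vertices matter: with S and D the half sum and
   half difference of F_i y and F_j y, orthogonality reads |S| <= |D|, and S
   and D are proportional to the coordinates of y along and across x. If n is
   odd, the form F_k whose normal is orthogonal to x satisfies
   D = sin b * F_k y, so |S| <= sin b. If n is even, the two forms closest to
   the orthogonal direction give cos^2 b |D| + sin^2 b |S| <= sin b cos b,
   so |S| <= sin b cos b. Equality holds for y on the boundary of the
   orthogonality cone: a vertex if n is odd, an edge midpoint if n is even. *)
Require Import Defs.
From mathcomp Require Import ring lra zify.
Import Order.TTheory GRing.Theory Num.Theory.
Import numFieldNormedType.Exports.
Local Open Scope classical_set_scope.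
Local Open Scope ring_scope.

Set Implicit Arguments.
Unset Strict Implicit.
Unset Printing Implicit Defensive.

(** * Norms that are a maximum of finitely many linear forms *)

Section PolyhedralNorm.
Context {R : realType} {X : normedModType R}.
Variables (N : nat) (F : nat -> X -> R).
Hypothesis F_lin : forall k x y t, F k (x + t *: y) = F k x + t * F k y.
Hypothesis F_le : forall k x, F k x <= `|x|.
Hypothesis F_attained : forall x, exists2 k, (k < N)%N & `|x| = F k x.

Variables (x : X) (a b : nat).
Hypothesis Fax : F a x = `|x|.
Hypothesis Fbx : F b x = `|x|.
(** Forms are compared as functions, since different indices may give the same form. The case
    [a = b] is allowed and describes a point inside a face. *)
Hypothesis F_inactive : forall k, (k < N)%N ->
  [\/ F k x < `|x|, F k =1 F a | F k =1 F b].

(** The finitely many forms strictly below the norm at [x] stay below [F a] for small [t], so near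
    [x] the norm is attained by [F a] or [F b]. *)
Lemma norm_near_face y :
  \forall t \near (0 : R),
    `|x + t *: y| = `|x| + Num.max (t * F a y) (t * F b y).
Proof.
have H (k : 'I_N) : \forall t \near (0 : R),
    F k x < `|x| -> F k (x + t *: y) < F a (x + t *: y).
  have [kx|] := boolP (F k x < `|x|); last first.
    by move=> _; near=> t.
  (* Growth rate of [F k - F a] along [y], with 1 added so that the gap at [x] can be divided by
     it. *)
  set D := `|F k y - F a y| + 1.
  have D0 : 0 < D by rewrite ltr_wpDl.
  have e0 : 0 < (`|x| - F k x) / D by rewrite divr_gt0 // subr_gt0.
  near=> t => _.
  have : `|t| < (`|x| - F k x) / D by near: t; exact: (@nbhs0_lt R R^o).
  rewrite ltr_pdivlMr // => tD.
  have : t * (F k y - F a y) <= `|t| * D.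
    apply: le_trans (ler_norm _) _; rewrite normrM ler_wpM2l //.
    by rewrite lerDl.
  rewrite !F_lin Fax; lra.
apply: filterS (filter_forall _ H) => t Ht.
apply/eqP; rewrite eq_le; apply/andP; split; last first.
  have /= := (F_le a (x + t *: y), F_le b (x + t *: y)).
  rewrite !F_lin Fax Fbx => -[Ha Hb].
  by rewrite -lerBrDl ge_max !lerBrDl Ha.
have [k kN kE] := F_attained (x + t *: y).
have [kx|ka|kb] := F_inactive kN.
- have := Ht (Ordinal kN) kx; rewrite /= -kE => /lt_le_trans/(_ (F_le a _)).
  by rewrite ltxx.
- by rewrite kE ka F_lin Fax lerD2l le_max lexx.
- by rewrite kE kb F_lin Fbx lerD2l le_max lexx orbT.
Unshelve. all: by end_near. Qed.

(** The right quotient is eventually the maximum of the two values. Dividing by a negative [t] turns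
    it into the minimum, and maximum plus minimum is the sum. *)
Lemma rho_face y : rho x y = `|x| * ((F a y + F b y) / 2).
Proof.
have -> : rho x y = (`|x| * Num.max (F a y) (F b y)
                   + `|x| * Num.min (F a y) (F b y)) / 2.
  rewrite /rho; congr ((_ + _) / 2); congr (_ * _).
  - apply: lim_near_cst; first exact: Rhausdorff.
    near=> t.
    have t0 : 0 < t by near: t; exact: nbhs_right_gt.
    have -> : `|x + t *: y| = `|x| + Num.max (t * F a y) (t * F b y).
      by near: t; apply: cvg_within; exact: norm_near_face.
    by rewrite addrAC subrr add0r -maxr_pMr ?ltW// mulrAC divff ?mul1r ?gt_eqF.
  - apply: lim_near_cst; first exact: Rhausdorff.
    near=> t.
    have t0 : t < 0 by near: t; exact: nbhs_left_lt.
    have -> : `|x + t *: y| = `|x| + Num.max (t * F a y) (t * F b y).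
      by near: t; apply: cvg_within; exact: norm_near_face.
    by rewrite addrAC subrr add0r -minr_nMr ?ltW// mulrAC divff ?mul1r ?lt_eqF.
by rewrite -mulrDr addr_max_min mulrA.
Unshelve. all: by end_near. Qed.

(** With values of opposite signs, one active form does not decrease whatever the sign of [t]. With
    the same strict sign, a small step against it shortens [x]. *)
Lemma birkhoff_james_face y : birkhoff_james x y <-> F a y * F b y <= 0.
Proof.
split=> [xy|Fy t]; last first.
  have := (F_le a (x + t *: y), F_le b (x + t *: y)).
  rewrite /= !F_lin Fax Fbx => -[Ha Hb].
  by have [?|?] := leP 0 t; have [?|?] := leP 0 (F a y); nra.
rewrite leNgt; apply/negP => Fab.
have [e /= e0 He] := norm_near_face y.
(* A step inside the neighbourhood, of sign opposite to the common sign of [F a y] and [F b y]. *)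
set s : R := if 0 < F a y then - (e / 2) else e / 2.
have se : ball 0 e s.
  rewrite /ball /= sub0r normrN /s.
  by case: ifP => _; rewrite ?normrN gtr0_norm; lra.
have := xy s; rewrite (He s se) -lerBlDl subrr le_max /s.
move: Fab; case: ifPn => [a0|].
  by rewrite pmulr_rgt0 // => b0 /orP[]; nra.
rewrite -leNgt le_eqVlt => /orP[/eqP ->|a0]; first by rewrite mul0r ltxx.
by rewrite nmulr_rgt0 // => b0 /orP[]; nra.
Qed.

End PolyhedralNorm.

(** * Trigonometry of half the central angle of an edge *)

Section Polygon.
Context {R : realType}.
Variable n : nat.
Hypothesis n_gt1 : (1 < n)%N.

Definition half_step : R := pi / (2 * n%:R).

Let b := half_step.

Let n0 : n%:R != 0 :> R.
Proof. by rewrite pnatr_eq0; lia. Qed.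

Lemma mul_half_step : n%:R * b = pi / 2.
Proof. by rewrite /b /half_step; field. Qed.

Lemma mul_half_step2 : (2 * n)%:R * b = pi.
Proof. by rewrite natrM -mulrA mul_half_step; lra. Qed.

Lemma half_step_gt0 : 0 < b.
Proof. by rewrite divr_gt0 ?pi_gt0// mulr_gt0 // ltr0n; lia. Qed.

Lemma mul_half_step_itv (m : nat) : (0 < m < 2 * n)%N -> 0 < m%:R * b < pi.
Proof.
move=> /andP[m0 mn]; rewrite mulr_gt0 ?ltr0n ?half_step_gt0//=.
by rewrite -mul_half_step2 ltr_pM2r ?half_step_gt0// ltr_nat.
Qed.

Lemma cos_half_step_gt0 : 0 < cos b.
Proof.
have : 0 < 2%:R * b < pi by apply: mul_half_step_itv; lia.
move=> /andP[b0 bpi]; apply: cos_gt0_pihalf; lra.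
Qed.

Lemma sin_half_step_gt0 : 0 < sin b.
Proof.
have : 0 < 1%:R * b < pi by apply: mul_half_step_itv; lia.
by rewrite mul1r => /sin_gt0_pi.
Qed.

(** Product form of the difference: its sign can be read off from sines of angles in [0, pi]. *)
Lemma cos_odd_half_step_sub (m : nat) :
  cos b - cos ((2 * m%:R + 1) * b) = 2 * (sin (m%:R * b) * sin (m.+1%:R * b)).
Proof.
have -> : cos b = cos (m.+1%:R * b - m%:R * b).
  by congr cos; rewrite -natr1; ring.
have -> : (2 * m%:R + 1) * b = m.+1%:R * b + m%:R * b.
  by rewrite -natr1; ring.
rewrite cosB cosD; ring.
Qed.

Lemma cos_odd_half_step_lt (m : nat) : (0 < m)%N -> (m.+1 < 2 * n)%N ->
  cos ((2 * m%:R + 1) * b) < cos b.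
Proof.
move=> m0 mn; rewrite -subr_gt0 cos_odd_half_step_sub mulr_gt0// mulr_gt0//.
- by apply/sin_gt0_pi/mul_half_step_itv; lia.
- by apply/sin_gt0_pi/mul_half_step_itv; lia.
Qed.

Lemma cos_odd_half_step_le (m : nat) : (m < 2 * n)%N ->
  cos ((2 * m%:R + 1) * b) <= cos b.
Proof.
move=> mn; case: (posnP m) => [->|m0].
  by rewrite mulr0 add0r mul1r.
have [?|?] := ltnP m.+1 (2 * n); first exact/ltW/cos_odd_half_step_lt.
(* Extreme case of equality: the second sine is that of pi. *)
have -> : m = (2 * n).-1 by lia.
rewrite -subr_ge0 cos_odd_half_step_sub prednK; last lia.
by rewrite mul_half_step2 sinpi !mulr0.
Qed.

(** * Edge forms and their values on the polygon *)

Variables (r theta : R).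
Hypothesis r_gt0 : 0 < r.

(* Edge k, from vertex k to vertex k+1, lies on the line [edge_form k z = 1]. *)
Definition edge_form (k : nat) (z : 'rV[R]_2) : R :=
  (z 0 0 * cos (theta + (2 * k%:R + 1) * b)
   + z 0 1 * sin (theta + (2 * k%:R + 1) * b)) / (r * cos b).

Lemma edge_form_lin k x y t :
  edge_form k (x + t *: y) = edge_form k x + t * edge_form k y.
Proof. by rewrite /edge_form !mxE; ring. Qed.

Lemma edge_form0 k : edge_form k 0 = 0.
Proof. by rewrite /edge_form !mxE !mul0r addr0 mul0r. Qed.

Lemma edge_formZ k t y : edge_form k (t *: y) = t * edge_form k y.
Proof. by rewrite -[t *: y]add0r edge_form_lin edge_form0 add0r. Qed.

Lemma edge_formN k y : edge_form k (- y) = - edge_form k y.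
Proof. by rewrite -scaleN1r edge_formZ mulN1r. Qed.

Lemma edge_form_convex k t p q :
  edge_form k ((1 - t) *: p + t *: q)
  = (1 - t) * edge_form k p + t * edge_form k q.
Proof. by rewrite edge_form_lin edge_formZ. Qed.

Lemma edge_form_period k : edge_form (k + 2 * n) =1 edge_form k.
Proof.
move=> z; rewrite /edge_form.
have -> : theta + (2 * (k + 2 * n)%:R + 1) * b
        = theta + (2 * k%:R + 1) * b + pi *+ 2.
  have := mul_half_step; rewrite natrD natrM => h.
  by rewrite mulr2n; nra.
by rewrite cosD2pi sinD2pi.
Qed.

(** Allows indices such as [j.+1 + l] to run past [2 * n]. *)
Lemma edge_form_mod k : edge_form k =1 edge_form (k %% (2 * n)).
Proof.
move=> z; rewrite {1}(divn_eq k (2 * n)) addnC.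
by elim: (k %/ _)%N => [|q IH];
  rewrite ?addn0// (mulSnr q) addnA edge_form_period.
Qed.

Local Notation vertex := (polygon_vertex (2 * n) r theta).

Lemma edge_form_vertex k j :
  edge_form k (vertex j) = cos ((2 * k%:R + 1 - 2 * j%:R) * b) / cos b.
Proof.
have cb := cos_half_step_gt0.
rewrite /edge_form /polygon_vertex /plane_point !mxE /=.
have -> : theta + j%:R * (2 * pi / (2 * n)%:R) = theta + 2 * j%:R * b.
  by rewrite /b /half_step natrM; field.
have -> : (2 * k%:R + 1 - 2 * j%:R) * b
    = (theta + (2 * k%:R + 1) * b) - (theta + 2 * j%:R * b) by ring.
rewrite cosB; field.
by rewrite !gt_eqF.
Qed.

(** Cosine is even, so the angle between the normal of edge k and vertex j can be taken as a
    positive odd multiple of [b]. *)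
Lemma edge_form_vertex_odd k j : edge_form k (vertex j)
  = cos ((2 * (if (j <= k)%N then k - j else j - k.+1)%N%:R + 1) * b) / cos b.
Proof.
rewrite edge_form_vertex; congr (_ / _); case: ifPn => jk.
  by rewrite natrB//; congr cos; ring.
rewrite -cosN natrB; last by lia.
by congr cos; rewrite -natr1; ring.
Qed.

Lemma edge_form_vertex_le k j : (k < 2 * n)%N -> (j <= 2 * n)%N ->
  edge_form k (vertex j) <= 1.
Proof.
move=> kn jn; have cb := cos_half_step_gt0.
rewrite edge_form_vertex_odd ler_pdivrMr// mul1r.
by apply: cos_odd_half_step_le; case: ifPn; lia.
Qed.

(** The excluded pairs are those where edge k has vertex j as an endpoint; the last two arise
    because vertices 0 and [2 * n] coincide. *)
Lemma edge_form_vertex_lt k j : (k < 2 * n)%N -> (j <= 2 * n)%N ->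
  ~~ [|| k == j, k.+1 == j, (j == 0) && (k.+1 == 2 * n)%N
       | (j == 2 * n)%N && (k == 0)] ->
  edge_form k (vertex j) < 1.
Proof.
move=> kn jn kj; have cb := cos_half_step_gt0.
rewrite edge_form_vertex_odd ltr_pdivrMr// mul1r.
by apply: cos_odd_half_step_lt; case: ifPn; lia.
Qed.

Lemma edge_form_start k : edge_form k (vertex k) = 1.
Proof.
by rewrite edge_form_vertex addrAC subrr add0r mul1r divff// gt_eqF//
  cos_half_step_gt0.
Qed.

Lemma edge_form_end k : edge_form k (vertex k.+1) = 1.
Proof.
rewrite edge_form_vertex -(natr1 k).
have -> : (2 * k%:R + 1 - 2 * (k%:R + 1)) * b = - b by ring.
by rewrite cosN divff// gt_eqF// cos_half_step_gt0.
Qed.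

Lemma polygon_boundary_le z k : (k < 2 * n)%N ->
  polygon_boundary (2 * n) r theta z -> edge_form k z <= 1.
Proof.
move=> kn [j jn [t /andP[t0 t1] ->]]; rewrite edge_form_convex.
have h1 : edge_form k (vertex j) <= 1 by apply: edge_form_vertex_le => //; lia.
have h2 : edge_form k (vertex j.+1) <= 1 by exact: edge_form_vertex_le.
by nra.
Qed.

Lemma polygon_boundary_attained z : polygon_boundary (2 * n) r theta z ->
  exists2 k, (k < 2 * n)%N & edge_form k z = 1.
Proof.
move=> [j jn [t _ ->]]; exists j => //.
by rewrite edge_form_convex edge_form_start edge_form_end; ring.
Qed.

Lemma vertex_period : vertex (2 * n) = vertex 0.
Proof.
rewrite /polygon_vertex mul0r addr0.
have -> : (2 * n)%:R * (2 * pi / (2 * n)%:R) = pi *+ 2 :> R.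
  by rewrite natrM mulr2n; field.
by rewrite cosD2pi sinD2pi.
Qed.

Lemma polygon_boundary_cases z : polygon_boundary (2 * n) r theta z ->
  exists2 j, (j < 2 * n)%N & z = vertex j.+1 \/
    forall k, (k < 2 * n)%N -> k != j -> edge_form k z < 1.
Proof.
move=> [j jn [t /andP[t0 t1] zE]].
have [t1E|tn1] := eqVneq t 1.
  by exists j => //; left; rewrite zE t1E subrr scale0r add0r scale1r.
have [t0E|tn0] := eqVneq t 0.
  have {zE} -> : z = vertex j by rewrite zE t0E subr0 scale1r scale0r addr0.
  case: j jn => [_|j jn]; last by exists j; [lia|left].
  (* Vertex 0 is recorded as vertex [2 * n], so that the edges meeting at a vertex are always [j]
     and [j.+1]. *)
  by exists (2 * n).-1; [lia|left; rewrite prednK ?vertex_period//; lia].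
have {}t0 : 0 < t by rewrite lt_neqAle eq_sym tn0.
have {}t1 : t < 1 by rewrite lt_neqAle tn1.
exists j => //; right=> k kn kj; rewrite zE edge_form_convex.
have h1 : edge_form k (vertex j) <= 1 by apply: edge_form_vertex_le => //; lia.
have h2 : edge_form k (vertex j.+1) <= 1 by exact: edge_form_vertex_le.
(* Another edge misses at least one end of edge [j]: the start if it is the next edge, the far end
   otherwise. Strictness at one end suffices inside the edge. *)
have [kj1|kj1] := boolP ((k == j.+1) || (j.+1 == 2 * n)%N && (k == 0)).
  suff : edge_form k (vertex j) < 1 by nra.
  by apply: edge_form_vertex_lt; lia.
suff : edge_form k (vertex j.+1) < 1 by nra.
by apply: edge_form_vertex_lt; lia.
Qed.

Lemma edge_form_vertex_inactive j k : (j < 2 * n)%N -> (k < 2 * n)%N ->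
  [\/ edge_form k (vertex j.+1) < 1, edge_form k =1 edge_form j
    | edge_form k =1 edge_form j.+1].
Proof.
move=> jn kn.
have [->|kj] := eqVneq k j; first by constructor 2.
have [->|kj1] := eqVneq k j.+1; first by constructor 3.
have [/andP[/eqP jE /eqP ->]|h] := boolP ((j.+1 == 2 * n)%N && (k == 0)).
  by constructor 3 => z; rewrite jE -(edge_form_period 0).
by constructor 1; apply: edge_form_vertex_lt; lia.
Qed.

(** Vertex [j.+1] has direction [g] and the adjacent normals have directions [g - b] and [g + b], so
    their difference points along [g + pi / 2]. For odd [n] this is the normal of edge
    [j.+1 + l]. *)
Lemma edge_form_sub_odd l j z : n = l.*2.+1 ->
  edge_form j.+1 z - edge_form j z = 2 * sin b * edge_form (j.+1 + l) z.
Proof.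
move=> nE; rewrite /edge_form -(natr1 j).
set g := theta + (2 * j%:R + 2) * b.
have -> : theta + (2 * (j%:R + 1) + 1) * b = g + b by rewrite /g; ring.
have -> : theta + (2 * j%:R + 1) * b = g - b by rewrite /g; ring.
have -> : theta + (2 * (j.+1 + l)%:R + 1) * b = g + pi / 2.
  rewrite -mul_half_step nE -muln2 natrD -(natr1 j) -(natr1 (l * 2)) natrM /g.
  ring.
rewrite cosDpihalf sinDpihalf cosB sinB cosD sinD; ring.
Qed.

(** For even [n] no normal has direction [g + pi / 2]; the nearest ones deviate from it by [b] on
    either side. This is the one at [g + pi / 2 - b]. *)
Lemma edge_form_even l j z : n = l.*2 ->
  sin b * cos b * edge_form (j + l) z
  = cos b ^+ 2 * ((edge_form j.+1 z - edge_form j z) / 2)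
    + sin b ^+ 2 * ((edge_form j z + edge_form j.+1 z) / 2).
Proof.
move=> nE; rewrite /edge_form -(natr1 j).
set g := theta + (2 * j%:R + 2) * b.
have -> : theta + (2 * (j%:R + 1) + 1) * b = g + b by rewrite /g; ring.
have -> : theta + (2 * j%:R + 1) * b = g - b by rewrite /g; ring.
have -> : theta + (2 * (j + l)%:R + 1) * b = g - b + pi / 2.
  by rewrite -mul_half_step nE -muln2 natrD natrM /g; ring.
rewrite cosDpihalf sinDpihalf cosB sinB cosD sinD.
by field; rewrite !gt_eqF ?cos_half_step_gt0.
Qed.

(** The mirror normal, at [g + pi / 2 + b]; reflection across the direction [g + pi / 2] changes the
    sign of the half sum. *)
Lemma edge_form_even_succ l j z : n = l.*2 ->
  sin b * cos b * edge_form (j.+1 + l) z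
  = cos b ^+ 2 * ((edge_form j.+1 z - edge_form j z) / 2)
    - sin b ^+ 2 * ((edge_form j z + edge_form j.+1 z) / 2).
Proof.
move=> nE; rewrite /edge_form -(natr1 j).
set g := theta + (2 * j%:R + 2) * b.
have -> : theta + (2 * (j%:R + 1) + 1) * b = g + b by rewrite /g; ring.
have -> : theta + (2 * j%:R + 1) * b = g - b by rewrite /g; ring.
have -> : theta + (2 * (j.+1 + l)%:R + 1) * b = g + b + pi / 2.
  by rewrite -mul_half_step nE -muln2 natrD -(natr1 j) natrM /g; ring.
rewrite cosDpihalf sinDpihalf cosB sinB cosD sinD.
by field; rewrite !gt_eqF ?cos_half_step_gt0.
Qed.

End Polygon.

(** * Transfer to a normed space with polygonal unit sphere *)

Section PolygonalSphere.
Context {R : realType} {X : normedModType R}.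
Variables (n : nat) (phi : {linear X -> 'rV[R]_2}) (r theta : R).
Hypothesis n_gt1 : (1 < n)%N.
Hypothesis r_gt0 : 0 < r.
Hypothesis sphereE :
  phi @` unit_sphere X = polygon_boundary (2 * n) r theta.

Local Notation b := (half_step n : R).
Local Notation vertex := (polygon_vertex (2 * n) r theta).
Local Notation F := (fun k x => edge_form n r theta k (phi x)).

Lemma face_lin k x y t : F k (x + t *: y) = F k x + t * F k y.
Proof. by rewrite /= linearD linearZ edge_form_lin. Qed.

Lemma polygon_of_sphere x : `|x| = 1 ->
  polygon_boundary (2 * n) r theta (phi x).
Proof. by move=> x1; rewrite -sphereE; exists x. Qed.

Lemma sphere_of_polygon z : polygon_boundary (2 * n) r theta z ->
  exists2 x, `|x| = 1 & phi x = z.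
Proof. by rewrite -sphereE => -[x x1 <-]; exists x. Qed.

Lemma face_normalize k x : x != 0 -> F k x = `|x| * F k (`|x|^-1 *: x).
Proof.
move=> x0; rewrite /= linearZ edge_formZ mulrA divff ?mul1r//.
by rewrite normr_eq0.
Qed.

Lemma norm_normalize (x : X) : x != 0 -> `| `|x|^-1 *: x| = 1.
Proof.
by move=> x0; rewrite normrZ normfV normr_id mulVf// normr_eq0.
Qed.

Lemma face_le k x : F k x <= `|x|.
Proof.
have [->|x0] := eqVneq x 0; first by rewrite /= linear0 edge_form0 normr0.
rewrite face_normalize// ler_piMr//= edge_form_mod//.
apply: (polygon_boundary_le n_gt1 r_gt0).
  by rewrite ltn_mod; lia.
exact/polygon_of_sphere/norm_normalize.
Qed.

(** The lower bound is the upper bound at [- x]. *)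
Lemma face_norm_le k x : `|F k x| <= `|x|.
Proof.
rewrite ler_norml face_le andbT lerNl /= -edge_formN -linearN -(normrN x).
exact: face_le.
Qed.

Lemma face_attained x : exists2 k, (k < 2 * n)%N & `|x| = F k x.
Proof.
have [->|x0] := eqVneq x 0.
  by exists 0; [lia|rewrite /= linear0 edge_form0 normr0].
have [k kn kE] := polygon_boundary_attained n_gt1 r_gt0
  (polygon_of_sphere (norm_normalize x0)).
by exists k; rewrite // face_normalize//= kE mulr1.
Qed.

Lemma face_vertex j x : phi x = vertex j.+1 -> F j x = 1 /\ F j.+1 x = 1.
Proof.
by move=> /= ->; rewrite edge_form_end// edge_form_start.
Qed.

Lemma rho_vertex j x y : (j < 2 * n)%N -> `|x| = 1 -> phi x = vertex j.+1 ->
  rho x y = (F j y + F j.+1 y) / 2.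
Proof.
move=> jn x1 xE; have [Fj Fj1] := face_vertex xE.
rewrite (rho_face face_lin face_le face_attained (x := x) (a := j) (b := j.+1)).
- by rewrite x1 mul1r.
- by rewrite x1.
- by rewrite x1.
- move=> k kn; rewrite x1 xE.
  by case: (edge_form_vertex_inactive n_gt1 theta r_gt0 jn kn) => h;
    [constructor 1|constructor 2 => z; exact: h|constructor 3 => z; exact: h].
Qed.

Lemma birkhoff_james_vertex j x y : (j < 2 * n)%N -> `|x| = 1 ->
  phi x = vertex j.+1 -> birkhoff_james x y <-> F j y * F j.+1 y <= 0.
Proof.
move=> jn x1 xE; have [Fj Fj1] := face_vertex xE.
apply: (birkhoff_james_face face_lin face_le face_attained).
- by rewrite x1.
- by rewrite x1.
- move=> k kn; rewrite x1 xE.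
  by case: (edge_form_vertex_inactive n_gt1 theta r_gt0 jn kn) => h;
    [constructor 1|constructor 2 => z; exact: h|constructor 3 => z; exact: h].
Qed.

(** Here [F j] is the only active form, so orthogonality says that the square of [F j y] is at most
    0. *)
Lemma rho_edge j x y : (j < 2 * n)%N -> `|x| = 1 ->
  (forall k, (k < 2 * n)%N -> k != j -> F k x < 1) ->
  birkhoff_james x y -> rho x y = 0.
Proof.
move=> jn x1 xlt.
have inact k : (k < 2 * n)%N -> [\/ F k x < `|x|, F k =1 F j | F k =1 F j].
  move=> kn; have [->|kj] := eqVneq k j; first by constructor 2.
  by constructor 1; rewrite x1; exact: xlt.
have Fj : F j x = `|x|.
  have [k kn kE] := face_attained x; have [<-//|kj] := eqVneq k j.
  by have := xlt k kn kj; rewrite -kE x1 ltxx.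
rewrite (rho_face face_lin face_le face_attained Fj Fj inact).
move=> /(birkhoff_james_face face_lin face_le face_attained Fj Fj inact) h.
have -> : F j y = 0 by nra.
by rewrite addr0 mul0r mulr0.
Qed.

(** Reduces the supremum to a bound at the vertices and one extremal pair: vertex 1, where edges 0
    and 1 meet, and [y0], on the boundary of its orthogonality cone. *)
Lemma Gamma_polygon c y0 : 0 <= c ->
  (forall j y, (j < 2 * n)%N -> `|y| = 1 -> F j y * F j.+1 y <= 0 ->
    `|(F j y + F j.+1 y) / 2| <= c) ->
  polygon_boundary (2 * n) r theta y0 ->
  edge_form n r theta 0 y0 = 0 -> edge_form n r theta 1 y0 = 2 * c ->
  Gamma X = c.
Proof.
move=> c0 cmax y0P y00 y01; rewrite /Gamma; set E := [set _ | _].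
have Ec : E c.
  have [y y1 yE] := sphere_of_polygon y0P.
  have [x x1 xE] : exists2 x, `|x| = 1 & phi x = vertex 1.
    apply: sphere_of_polygon; exists 0; first by lia.
    by exists 1; rewrite ?ler01 ?lexx// subrr scale0r add0r scale1r.
  exists x, y; split => //.
    by apply/(birkhoff_james_vertex (j := 0)); rewrite //= ?yE ?y00 ?mul0r//; lia.
  rewrite (rho_vertex (j := 0))//=; last by lia.
  by rewrite yE y00 y01 add0r mulrC mulKf// ger0_norm.
have Eub : ubound E c.
  move=> _ [x [y [x1 y1 xy ->]]].
  have [j jn [xE|xlt]] :=
    polygon_boundary_cases n_gt1 r_gt0 (polygon_of_sphere x1).
  - rewrite (rho_vertex y jn x1 xE); apply: cmax => //.
    by apply/(birkhoff_james_vertex _ jn x1 xE).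
  - by rewrite (rho_edge jn x1 xlt xy) normr0.
apply/eqP; rewrite eq_le ge_sup//=; last by exists c.
by apply: ub_le_sup => //; exists c.
Qed.

(** * The value of the constant for each parity of [n] *)

Lemma normD_le_normB (p q : R) : p * q <= 0 -> `|p + q| <= `|q - p|.
Proof.
by move=> pq; rewrite -ler_sqr ?nnegrE// !real_normK ?num_real//; nra.
Qed.

Lemma Gamma_polygon_odd : odd n -> Gamma X = sin b.
Proof.
move=> on; have nE : n = n./2.*2.+1 by rewrite -[LHS]odd_double_half on.
set l := n./2 in nE.
have s0 : 0 < sin b := sin_half_step_gt0 n_gt1.
(* This vertex makes the angle [n%:R * b], a right angle, with the normal of edge 0. *)
have v0 : edge_form n r theta 0 (vertex l.+1) = 0.
  rewrite edge_form_vertex//.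
  have -> : (2 * 0%:R + 1 - 2 * l.+1%:R) * b = - (n%:R * b).
    by rewrite [in n%:R]nE -muln2 -!natr1 natrM; ring.
  by rewrite cosN mul_half_step// cos_pihalf mul0r.
apply: (Gamma_polygon (y0 := vertex l.+1)) => //; first exact: ltW.
- move=> j y jn y1 /normD_le_normB.
  have f1 : `|edge_form n r theta (j.+1 + l) (phi y)| <= 1.
    by rewrite -y1; exact: face_norm_le.
  rewrite (edge_form_sub_odd n_gt1 _ _ _ _ nE).
  move: (edge_form _ _ _ (j.+1 + l) _) f1 => f f1.
  rewrite (normrM _ f) (normrM _ 2^-1) gtr0_norm ?mulr_gt0//.
  rewrite (@gtr0_norm _ 2^-1) ?invr_gt0// => pq.
  by rewrite ler_pdivrMr// (le_trans pq)// [leRHS]mulrC ler_piMr// ltW ?mulr_gt0.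
- exists l; first by lia.
  by exists 1; rewrite ?ler01 ?lexx// subrr scale0r add0r scale1r.
- have := edge_form_sub_odd n_gt1 r theta 0 (vertex l.+1) nE.
  by rewrite v0 subr0 add1n edge_form_start// mulr1.
Qed.

Lemma Gamma_polygon_even : ~~ odd n -> Gamma X = sin b * cos b.
Proof.
move=> en; have nE : n = n./2.*2.
  by rewrite -[LHS]odd_double_half (negbTE en).
set l := n./2 in nE.
have s0 : 0 < sin b := sin_half_step_gt0 n_gt1.
have c0 : 0 < cos b := cos_half_step_gt0 n_gt1.
(* The midpoint of edge [l] lies along the normal of that edge, at a right angle to the normal of
   edge 0. *)
set m := (1 - 1 / 2) *: vertex l + (1 / 2) *: vertex l.+1.
have m0 : edge_form n r theta 0 m = 0.
  rewrite /m edge_form_convex !edge_form_vertex//.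
  have -> : (2 * 0%:R + 1 - 2 * l%:R) * b = b - n%:R * b.
    by rewrite [in n%:R]nE -muln2 natrM; ring.
  have -> : (2 * 0%:R + 1 - 2 * l.+1%:R) * b = - (b + n%:R * b).
    by rewrite [in n%:R]nE -muln2 -(natr1 l) natrM; ring.
  by rewrite cosN cosB cosD mul_half_step// cos_pihalf; lra.
apply: (Gamma_polygon (y0 := m)) => //; first by rewrite ltW ?mulr_gt0.
- move=> j y jn y1 /normD_le_normB.
  have := edge_form_even_succ n_gt1 theta r_gt0 j (phi y) nE.
  have := edge_form_even n_gt1 theta r_gt0 j (phi y) nE.
  have := (face_norm_le (j + l) y, face_norm_le (j.+1 + l) y).
  rewrite y1 /= => -[f1 f2] e1 e2 pq.
  set p := edge_form n r theta j _ in e1 e2 pq *.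
  set q := edge_form n r theta j.+1 _ in e1 e2 pq *.
  have {pq} : `|(p + q) / 2| <= `|(q - p) / 2|.
    by rewrite [leLHS]normrM [leRHS]normrM ler_wpM2r.
  move: ((q - p) / 2) ((p + q) / 2) e1 e2 => D S e1 e2 SD.
  have sc0 : 0 < sin b * cos b by exact: mulr_gt0.
  have h1 : `|cos b ^+ 2 * D + sin b ^+ 2 * S| <= sin b * cos b.
    by rewrite -e1 normrM (gtr0_norm sc0) ler_piMr// ltW.
  have h2 : `|cos b ^+ 2 * D - sin b ^+ 2 * S| <= sin b * cos b.
    by rewrite -e2 normrM (gtr0_norm sc0) ler_piMr// ltW.
  (* The larger of |u + v| and |u - v| is |u| + |v|. *)
  have h : cos b ^+ 2 * `|D| + sin b ^+ 2 * `|S| <= sin b * cos b.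
    move: h1 h2; rewrite !ler_norml => /andP[? ?] /andP[? ?].
    by case: (ger0P D) => _; case: (ger0P S) => _; lra.
  rewrite -[leLHS]mul1r -(cos2Dsin2 b) mulrDl; apply: le_trans h.
  by rewrite lerD2r ler_wpM2l// sqr_ge0.
- exists l; first by lia.
  by exists (1 / 2) => //; lra.
(* Form [l] is 1 at [m] and form 0 vanishes there, so the right side collapses to half of form 1. *)
- have := edge_form_even n_gt1 theta r_gt0 0 m nE.
  rewrite m0 add0n /m edge_form_convex edge_form_start// edge_form_end// -/m.
  by move=> e; rewrite -[LHS]mul1r -[X in X * _](cos2Dsin2 b); lra.
Qed.

End PolygonalSphere.

(** Complementary angles: [n%:R * half_step n] is a right angle. *)
Lemma cos_sub_half_step (R : realType) n (x : R) : (1 < n)%N ->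
  cos ((n%:R - x) / (2 * n%:R) * pi) = sin (x * half_step n).
Proof.
move=> n_gt1; have -> : (n%:R - x) / (2 * n%:R) * pi
    = n%:R * half_step n - x * half_step n by rewrite /half_step; ring.
by rewrite mul_half_step// cosB cos_pihalf sin_pihalf mul0r add0r mul1r.
Qed.

Theorem theorem2p10 (R : realType) (n : nat) (X : completeNormedModType R)
    (phi : {linear X -> 'rV[R]_2}) :
  (2 <= n)%N ->
  bijective phi ->
  regular_polygon_boundary (2 * n) (phi @` unit_sphere X) ->
  (odd n ->
     Gamma X = cos ((n%:R - 2) / (2 * n%:R) * pi)
               / (2 * cos (pi / (2 * n%:R)))) /\
  (~~ odd n ->
     Gamma X = 1 / (4 * cos (pi / (2 * n%:R)))
               * (cos ((n%:R - 3) / (2 * n%:R) * pi)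
                  + cos ((n%:R - 1) / (2 * n%:R) * pi))).
Proof.
move=> n_gt1 _ [r [theta [r_gt0 sphereE]]].
have c0 := cos_half_step_gt0 (R := R) n_gt1.
have sin2 : sin (2 * half_step n) = 2 * sin (half_step n) * cos (half_step n) :> R.
  by rewrite mulr_natl sin_mulr2n; ring.
rewrite -/(half_step n); split=> [on|en].
  rewrite (Gamma_polygon_odd n_gt1 r_gt0 sphereE on) cos_sub_half_step// sin2.
  by field; rewrite gt_eqF.
rewrite (Gamma_polygon_even n_gt1 r_gt0 sphereE en) !cos_sub_half_step// mul1r.
(* Writing 3b = 2b + b and b = 2b - b makes the sum of sines 2 sin 2b cos b. *)
have -> : sin (3 * half_step n) = sin (2 * half_step n + half_step n) :> R.
  by congr sin; ring.
have -> : sin (1 * half_step n) = sin (2 * half_step n - half_step n) :> R.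
  by congr sin; ring.
rewrite sinB sinD sin2.
by field; rewrite gt_eqF.
Qed.
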